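(* Let $G=(V,E,w)$ be an undirected, connected, weighted graph on $n$ vertices with Laplacian $L$, and for each $(a,b)\in E$ let $R_{ab}$ be the effective resistance of $(a,b)$. Let $0<\epsilon<1$, $0<\delta<1/2$, and let $k\le \log n$ be an even integer. Let $H$ be the (random) output of $\mathsf{Sparsify}(G,\{R_{ab}\}_{(a,b)\in E},k,\epsilon,\delta)$ and let $\tilde L$ be the Laplacian of $H$. Then with probability at least $1-2\delta$ both of the following hold: (1) $\tilde L\approx_\epsilon L$; and (2) $H$ has $O\!\left(\frac{1}{\delta^{1+2/k}}\cdot\frac{\log n}{\epsilon^2}\cdot n^{1+2/k}\right)$ edges.
   Context: The Laplacian of a weighted graph with adjacency matrix $A$ ($A_{ij}=w_{ij}$ if $(i,j)\in E$, else $0$) and diagonal weighted-degree matrix $D$ is $L=D-A$. $L^+$ denotes the Moore–Penrose pseudoinverse. The effective resistance of $(a,b)$ is $R_{ab}=(e_a-e_b)^\top L^+(e_a-e_b)$. For symmetric PSD matrices, $A\approx_\epsilon B$ means $(1-\epsilon)B\preceq A\preceq(1+\epsilon)B$. A distribution on $\{0,1\}^m$ is $k$-wise independent with marginals $p\in[0,1]^m$ if its restriction to every set of at most $k$ coordinates is distributed as independent Bernoulli bits with the corresponding means $p_i$. $\mathsf{Sparsify}(G,\{\tilde R_{ab}\}_{(a,b)\in E},k,\epsilon,\delta)$ is the following randomized procedure: set $s=\frac{18e\log n}{\epsilon^2}\left(\frac{n}{\delta}\right)^{2/k}$; for each $(a,b)\in E$ set $p_{ab}=\min\{1,w_{ab}\tilde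 R_{ab}s\}$; draw $x\in\{0,1\}^{E}$ from a $k$-wise independent distribution with marginals $(p_{ab})$; output the graph $H$ on vertex set $V$ containing each edge $(a,b)$ with $x_{ab}=1$, with weight $w_{ab}/p_{ab}$. *)

(* Defs.v *)
From HB Require Import structures.
From mathcomp Require Import all_boot all_order all_algebra.
From mathcomp Require Import boolp classical_sets reals sequences exp.

Set Implicit Arguments.
Unset Strict Implicit.
Unset Printing Implicit Defensive.

Import Order.TTheory GRing.Theory Num.Theory.

Local Open Scope ring_scope.

(* An undirected edge {a, b} is stored once, as the pair (a, b) with a < b.
   The weight is only meaningful on [edges]. *)
Record wgraph (R : Type) (n : nat) := WGraph {
  edges : {set 'I_n * 'I_n};
  weight : 'I_n * 'I_n -> R;
  edges_lt : forall e, e \in edges -> (e.1 < e.2)%N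
}.

Definition edge_type (R : Type) (n : nat) (G : wgraph R n) :=
  {e : 'I_n * 'I_n | e \in edges G}.

Definition adj (R : Type) (n : nat) (G : wgraph R n) : rel 'I_n :=
  fun a b => ((a, b) \in edges G) || ((b, a) \in edges G).

Definition connected_graph (R : Type) (n : nat) (G : wgraph R n) : Prop :=
  forall a b : 'I_n, connect (adj G) a b.

Definition positive_weights (R : numDomainType) (n : nat) (G : wgraph R n) :
    Prop :=
  forall e, e \in edges G -> 0 < weight G e.

Definition adjacency (R : nzRingType) (n : nat) (G : wgraph R n) : 'M[R]_n :=
  \matrix_(i, j) (if (i, j) \in edges G then weight G (i, j)
                  else if (j, i) \in edges G then weight G (j, i) else 0).

Definition degree_mx (R : nzRingType) (n : nat) (G : wgraph R n) : 'M[R]_n :=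
  diag_mx (\row_i \sum_j adjacency G i j).

Definition laplacian (R : nzRingType) (n : nat) (G : wgraph R n) : 'M[R]_n :=
  degree_mx G - adjacency G.

(* The four Penrose equations, for real matrices.  Note that the library's
   [pinvmx] is only a one-sided partial inverse, not the Moore-Penrose one. *)
Definition penrose (R : nzRingType) (m n : nat) (A : 'M[R]_(m, n))
    (P : 'M[R]_(n, m)) : Prop :=
  [/\ A *m P *m A = A, P *m A *m P = P,
      (A *m P)^T = A *m P & (P *m A)^T = P *m A].

Definition mp_pinv (R : nzRingType) (m n : nat) (A : 'M[R]_(m, n)) :
    'M[R]_(n, m) :=
  xget 0 [set P | penrose A P]%classic.

Lemma gram_unit (R : realFieldType) (m n : nat) (F : 'M[R]_(m, n)) :
  row_free F -> F *m F^T \in unitmx.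
Proof.
move=> Ffree; rewrite -row_free_unit -kermx_eq0; apply/rowV0P => v.
rewrite sub_kermx mulmxA => /eqP vFF; apply: (row_free_inj Ffree).
rewrite mul0mx; set u := v *m F.
have uu : u *m u^T = 0 by rewrite {2}/u trmx_mul mulmxA vFF mul0mx.
clearbody u; have {}uu : \sum_j u 0 j ^+ 2 = 0.
  have := congr1 (fun M : 'M_1 => M 0 0) uu; rewrite !mxE => e.
  by rewrite -[RHS]e; apply: eq_bigr => j _; rewrite mxE expr2.
apply/rowP => j; rewrite mxE; apply/eqP; rewrite -sqrf_eq0; apply/eqP.
by move/psumr_eq0P: uu => -> // i _; rewrite sqr_ge0.
Qed.

Lemma penrose_unique (R : comNzRingType) (m n : nat) (A : 'M[R]_(m, n))
    (P Q : 'M[R]_(n, m)) : penrose A P -> penrose A Q -> P = Q.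
Proof.
move=> [APA PAP AP PA] [AQA QAQ AQ QA].
have eAP : A *m P = A *m Q.
  by rewrite -AP -{1}AQA -mulmxA trmx_mul AP AQ mulmxA APA.
have ePA : P *m A = Q *m A.
  have -> : P *m A = (P *m A) *m (Q *m A) by rewrite -mulmxA (mulmxA A Q) AQA.
  rewrite -{1}PA -{1}QA -trmx_mul -mulmxA (mulmxA A) APA.
  exact: QA.
by rewrite -PAP ePA -mulmxA eAP mulmxA QAQ.
Qed.

Lemma penrose_mp_pinv (R : realFieldType) (m n : nat) (A : 'M[R]_(m, n)) :
  penrose A (mp_pinv A).
Proof.
suff [P hP] : exists P, penrose A P by apply: (@xgetPex _ _ (penrose A)); exists P.
have := mulmx_base A; set C := col_base A; set F := row_base A => defA.
have uF : F *m F^T \in unitmx by rewrite gram_unit ?row_base_free.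
have uC : C^T *m C \in unitmx.
  by rewrite -{2}[C]trmxK gram_unit // -row_leq_rank mxrank_tr col_leq_rank
             col_base_full.
clearbody C F; move: (\rank A) C F defA uF uC => r C F defA uF uC.
set IF := invmx (F *m F^T); set IC := invmx (C^T *m C).
have IFt : IF^T = IF by rewrite trmx_inv trmx_mul trmxK.
have ICt : IC^T = IC by rewrite trmx_inv trmx_mul trmxK.
exists (F^T *m IF *m (IC *m C^T)).
have hF : F *m F^T *m IF = 1%:M by rewrite mulmxV.
have hC : IC *m (C^T *m C) = 1%:M by rewrite mulVmx.
have AP : A *m (F^T *m IF *m (IC *m C^T)) = C *m IC *m C^T.
  by rewrite -defA !mulmxA -(mulmxA C F) -(mulmxA C (F *m F^T)) hF mulmx1.
have PA : F^T *m IF *m (IC *m C^T) *m A = F^T *m IF *m F.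
  by rewrite -defA !mulmxA -(mulmxA _ C^T C) -(mulmxA _ IC) hC mulmx1.
split.
- by rewrite AP -defA !mulmxA -(mulmxA _ C^T C) -(mulmxA _ IC) hC mulmx1.
- by rewrite PA !mulmxA -(mulmxA _ F F^T) -(mulmxA _ (F *m F^T)) hF mulmx1.
- by rewrite AP !trmx_mul trmxK ICt mulmxA.
- by rewrite PA !trmx_mul trmxK IFt mulmxA.
Qed.

Definition eff_resistance (R : nzRingType) (n : nat) (G : wgraph R n)
    (e : 'I_n * 'I_n) : R :=
  let v : 'cV[R]_n := delta_mx e.1 0 - delta_mx e.2 0 in
  (v^T *m mp_pinv (laplacian G) *m v) 0 0.

Definition psd (R : numDomainType) (n : nat) (M : 'M[R]_n) : Prop :=
  M^T = M /\ forall v : 'cV[R]_n, 0 <= (v^T *m M *m v) 0 0.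

Definition loewner (R : numDomainType) (n : nat) (A B : 'M[R]_n) : Prop :=
  psd (B - A).

Definition spectral_approx (R : numDomainType) (n : nat) (eps : R)
    (A B : 'M[R]_n) : Prop :=
  loewner ((1 - eps) *: B) A /\ loewner A ((1 + eps) *: B).

Definition is_distribution (R : numDomainType) (T : finType) (mu : T -> R) :
    Prop :=
  (forall t, 0 <= mu t) /\ \sum_t mu t = 1.

Definition Prob (R : numDomainType) (T : finType) (mu : T -> R)
    (P : T -> Prop) : R :=
  \sum_(t | `[< P t >]) mu t.

Definition kwise_independent (R : numDomainType) (I : finType) (k : nat)
    (p : I -> R) (mu : {ffun I -> bool} -> R) : Prop :=
  forall (S : {set I}) (y : {ffun I -> bool}), (#|S| <= k)%N ->
    Prob mu (fun x => forall i, i \in S -> x i = y i) =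
    \prod_(i in S) (if y i then p i else 1 - p i).

(* The logarithm is read as the natural one; [expR 1] is the constant e. *)
Definition sparsify_s (R : realType) (n k : nat) (eps delta : R) : R :=
  18%:R * expR 1 * ln n%:R / eps ^+ 2 * ((n%:R / delta) `^ (2%:R / k%:R)).

Definition sparsify_p (R : realType) (n : nat) (G : wgraph R n)
    (Rt : 'I_n * 'I_n -> R) (k : nat) (eps delta : R) (e : 'I_n * 'I_n) : R :=
  Num.min 1 (weight G e * Rt e * sparsify_s n k eps delta).

Definition sparsify_edges (R : realType) (n : nat) (G : wgraph R n)
    (x : {ffun edge_type G -> bool}) : {set 'I_n * 'I_n} :=
  [set val e | e : edge_type G & x e].

Lemma sparsify_edges_lt (R : realType) (n : nat) (G : wgraph R n)
    (x : {ffun edge_type G -> bool}) (e : 'I_n * 'I_n) :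
  e \in sparsify_edges x -> (e.1 < e.2)%N.
Proof. by case/imsetP => f _ ->; apply: (@edges_lt _ _ G); apply: valP. Qed.

(* The output of Sparsify when the sampled bits are x; the randomness of the
   procedure is a distribution on x (see [sparsify_sampling]). *)
Definition sparsify (R : realType) (n : nat) (G : wgraph R n)
    (Rt : 'I_n * 'I_n -> R) (k : nat) (eps delta : R)
    (x : {ffun edge_type G -> bool}) : wgraph R n :=
  @WGraph R n (sparsify_edges x)
    (fun e => weight G e / sparsify_p G Rt k eps delta e)
    (@sparsify_edges_lt R n G x).

Definition sparsify_sampling (R : realType) (n : nat) (G : wgraph R n)
    (Rt : 'I_n * 'I_n -> R) (k : nat) (eps delta : R)
    (mu : {ffun edge_type G -> bool} -> R) : Prop :=
  is_distribution mu /\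
  kwise_independent k
    (fun e : edge_type G => sparsify_p G Rt k eps delta (val e)) mu.

(* Main.v *)
Require Import Defs.
From mathcomp Require Import all_boot all_order all_algebra.
From mathcomp Require Import boolp classical_sets reals sequences exp.
From mathcomp Require Import ring lra zify.

Set Implicit Arguments.
Unset Strict Implicit.
Unset Printing Implicit Defensive.

Import Order.TTheory GRing.Theory Num.Theory.

Local Open Scope ring_scope.

(** Write the Laplacian as [L = Q Q^T], with one column of [Q] per edge, and let
    [Pi = Q^T L^+ Q], an orthogonal projection whose diagonal entries are the
    leverages [w_e R_e].  With [v_e = (column e of Pi) / sqrt p_e] and
    [Z = sum_e (x_e - p_e) v_e v_e^T] one has [L~ - L = Q Z Q^T], so it is enough
    to bound [E tr Z^k] and apply Markov's inequality.

    As [tr Z^k] has degree [k] in the bits, its mean is the same as under full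
    independence.  There, resampling the bit [e] in
    [tr Z^(m+2) = sum_e (x_e - p_e) v_e^T Z^(m+1) v_e] ([m] even) leaves
    differences [v^T (A^(m+1) - B^(m+1)) v] with [A - B = v v^T].  These telescope
    into products of moments [v^T A^j v] and [v^T B^(m-j) v], which are
    log-convex in [j] by Cauchy-Schwarz and hence controlled by the extreme terms
    [|v|^2 v^T A^m v] and [|v|^2 v^T B^m v].  Since [|v_e|^2 <= 1/s] whenever
    [p_e < 1], and [sum_e p_e v_e v_e^T = Pi <= 1], this gives
    [a_(m+2) <= ((m+1)/s) (a_(m+1) + 2 a_m)] for [a_m = E tr Z^m], hence
    [a_k <= n (5k/s)^(k/2)].  The number of edges is handled by Markov's
    inequality from [E #edges = sum_e p_e <= s tr Pi <= s n]. *)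

(** * Moments of symmetric matrices *)

Definition qform (R : nzRingType) (d : nat) (v : 'cV[R]_d) (A : 'M[R]_d) : R :=
  (v^T *m A *m v) 0 0.

Section QuadraticForm.
Variables (R : comNzRingType) (d : nat).
Implicit Types (u v : 'cV[R]_d) (A B : 'M[R]_d).

Lemma dotE u v : (u^T *m v) 0 0 = \sum_i u i 0 * v i 0.
Proof. by rewrite mxE; apply: eq_bigr => i _; rewrite mxE. Qed.

Lemma qform_dot v A : qform v A = \sum_i v i 0 * (A *m v) i 0.
Proof. by rewrite /qform -mulmxA dotE. Qed.

Lemma qformD v A B : qform v (A + B) = qform v A + qform v B.
Proof. by rewrite /qform mulmxDr mulmxDl mxE. Qed.

Lemma qformB v A B : qform v (A - B) = qform v A - qform v B.
Proof. by rewrite /qform mulmxBr mulmxBl mxE [in X in _ + X]mxE. Qed.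

Lemma qformZ v c A : qform v (c *: A) = c * qform v A.
Proof. by rewrite /qform -scalemxAr -scalemxAl mxE. Qed.

Lemma qform_scalev c v A : qform (c *: v) A = c ^+ 2 * qform v A.
Proof.
by rewrite /qform -scalemxAr [(c *: v)^T]linearZ /= -!scalemxAl scalerA mxE expr2.
Qed.

Lemma qform1 v : qform v 1%:M = (v^T *m v) 0 0.
Proof. by rewrite /qform mulmx1. Qed.

Lemma qform_sum (I : finType) v (F : I -> 'M[R]_d) :
  qform v (\sum_i F i) = \sum_i qform v (F i).
Proof. by rewrite /qform mulmx_sumr mulmx_suml summxE. Qed.

Lemma mxtrace_rank1 v A : \tr (v *m v^T *m A) = qform v A.
Proof. by rewrite -mulmxA mxtrace_mulC trace_mx11. Qed.

(** The rank-one middle factor cuts the product into two 1 by 1 blocks; telescoped differences of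
    powers thus become products of moments. *)
Lemma qform_rank1 v A B :
  qform v (A *m (v *m v^T) *m B) = qform v A * qform v B.
Proof.
rewrite /qform; set a := v^T *m A *m v; set b := v^T *m B *m v.
have -> : v^T *m (A *m (v *m v^T) *m B) *m v = a *m b by rewrite !mulmxA.
by rewrite mxE big_ord1.
Qed.

Lemma mxtrace_gram m n (A : 'M[R]_(m, n)) :
  \tr (A *m A^T) = \sum_i \sum_j A i j ^+ 2.
Proof.
apply: eq_bigr => i _; rewrite mxE; apply: eq_bigr => j _.
by rewrite mxE expr2.
Qed.

End QuadraticForm.

Lemma sum_qform_col (R : comNzRingType) (d m : nat) (A : 'M[R]_d)
    (Y : 'M[R]_(d, m)) : \tr (A *m (Y *m Y^T)) = \sum_j qform (col j Y) A.
Proof.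
rewrite mulmxA mxtrace_mulC; apply: eq_bigr => j _.
rewrite mxE qform_dot; apply: eq_bigr => i _; rewrite !mxE; congr (_ * _).
by apply: eq_bigr => l _; rewrite !mxE.
Qed.

Section Symmetric.
Variables (R : realFieldType) (d : nat).
Implicit Types (u v : 'cV[R]_d) (A B Z : 'M[R]_d).

Lemma dot_ge0 u : 0 <= (u^T *m u) 0 0.
Proof. by rewrite dotE; apply: sumr_ge0 => i _; rewrite -expr2 sqr_ge0. Qed.

Lemma CauchySchwarz_dot u v :
  (u^T *m v) 0 0 ^+ 2 <= (u^T *m u) 0 0 * (v^T *m v) 0 0.
Proof.
rewrite !dotE; set uv := \sum_i _; set uu := \sum_i _; set vv := \sum_i _.
have vv_ge0 : 0 <= vv by apply: sumr_ge0 => i _; rewrite -expr2 sqr_ge0.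
have [vv0|vv_neq0] := eqVneq vv 0.
  have v0 i : v i 0 = 0.
    apply/eqP; rewrite -sqrf_eq0 expr2; apply/eqP.
    by move/psumr_eq0P: vv0 => -> // j _; rewrite -expr2 sqr_ge0.
  by rewrite /uv big1 ?vv0 ?mulr0 ?expr0n // => i _; rewrite v0 mulr0.
have vv_gt0 : 0 < vv by rewrite lt_def vv_neq0.
(* This vector is [vv] times the component of [u] orthogonal to [v]; its squared norm carries a
   factor [vv] that cancels. *)
have : 0 <= \sum_i (vv * u i 0 - uv * v i 0) ^+ 2.
  by apply: sumr_ge0 => i _; rewrite sqr_ge0.
have -> : \sum_i (vv * u i 0 - uv * v i 0) ^+ 2 = vv * (uu * vv - uv ^+ 2).
  transitivity (\sum_i (vv ^+ 2 * (u i 0 * u i 0) +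
      ((- 2%:R * vv * uv) * (u i 0 * v i 0) + uv ^+ 2 * (v i 0 * v i 0)))).
    by apply: eq_bigr => i _; ring.
  by rewrite !big_split /= -!mulr_sumr -/uu -/uv -/vv; ring.
by rewrite pmulr_rge0 // subr_ge0.
Qed.

Lemma trmxX A n : (A ^+ n)^T = A^T ^+ n.
Proof.
elim: n => [|n IHn]; first by rewrite !expr0 trmx1.
by rewrite exprS exprSr -!mulmxE trmx_mul IHn.
Qed.

Lemma qform_powD Z v a b : Z^T = Z ->
  qform v (Z ^+ (a + b)) = ((Z ^+ a *m v)^T *m (Z ^+ b *m v)) 0 0.
Proof. by move=> sZ; rewrite /qform exprD -mulmxE trmx_mul trmxX sZ !mulmxA. Qed.

Lemma qform_pow_ge0 Z v a : Z^T = Z -> 0 <= qform v (Z ^+ a.*2).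
Proof. by move=> sZ; rewrite -addnn qform_powD // dot_ge0. Qed.

Lemma qform_pow_CS Z v a b : Z^T = Z ->
  qform v (Z ^+ (a + b)) ^+ 2 <= qform v (Z ^+ a.*2) * qform v (Z ^+ b.*2).
Proof.
by move=> sZ; rewrite -!addnn !qform_powD //; exact: CauchySchwarz_dot.
Qed.

Lemma mxtrace_pow_ge0 Z a : Z^T = Z -> 0 <= \tr (Z ^+ a.*2).
Proof.
move=> sZ; rewrite -addnn exprD -mulmxE -{2}sZ -trmxX mxtrace_gram.
by apply: sumr_ge0 => i _; apply: sumr_ge0 => j _; rewrite sqr_ge0.
Qed.

(** The trace is the sum of [qform y A] over the columns [y] of [Z ^+ a]. It is applied below to
    [A = 1 - M] and [A = (Z - c)^2]. *)
Lemma mxtrace_mulmx_pow_ge0 A Z a : Z^T = Z -> (forall v, 0 <= qform v A) ->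
  0 <= \tr (A *m Z ^+ a.*2).
Proof.
move=> sZ A_ge0; rewrite -addnn exprD -mulmxE -{2}sZ -trmxX sum_qform_col.
exact: sumr_ge0.
Qed.

(** Cauchy-Schwarz on each row of [Z ^+ a]; the squared row norms add up to the squared Frobenius
    norm, which is the trace. *)
Lemma qform_pow_le_trace Z v a : Z^T = Z ->
  qform v (Z ^+ a.*2) <= (v^T *m v) 0 0 * \tr (Z ^+ a.*2).
Proof.
move=> sZ; rewrite -addnn qform_powD // exprD -mulmxE -{4}sZ -trmxX mxtrace_gram.
set Y := Z ^+ a; rewrite dotE mulr_sumr; apply: ler_sum => i _.
have -> : (Y *m v) i 0 = ((row i Y)^T^T *m v) 0 0.
  by rewrite trmxK -row_mul [RHS]mxE.
rewrite -expr2 mulrC; apply: le_trans (CauchySchwarz_dot _ _) _.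
apply: ler_wpM2r; first exact: dot_ge0.
rewrite dotE; apply: ler_sum => j _.
by rewrite !mxE -expr2.
Qed.

(** Log-convexity makes the ratios of consecutive even moments nondecreasing, so each is at least
    the first; cross-multiplied, since moments may vanish. *)
Lemma qform_moment_mono Z v j : Z^T = Z ->
  qform v (Z ^+ 2) * qform v (Z ^+ j.*2) <=
  (v^T *m v) 0 0 * qform v (Z ^+ j.+1.*2).
Proof.
move=> sZ.
have q0 : qform v (Z ^+ 0.*2) = (v^T *m v) 0 0 by rewrite /qform expr0 mulmx1.
rewrite -q0.
elim: j => [|j IHj]; first by rewrite mulrC.
have := qform_pow_CS v j j.+2 sZ; rewrite (_ : j + j.+2 = j.+1.*2)%N; last by lia.
have [[a0 b0] c0] := (qform_pow_ge0 v j sZ, qform_pow_ge0 v j.+1 sZ,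
  qform_pow_ge0 v j.+2 sZ).
have z0 := qform_pow_ge0 v 0 sZ; have t0 := qform_pow_ge0 v 1 sZ.
move: a0 b0 c0 z0 t0 IHj; rewrite -[2%N]/(1.*2).
set a := qform _ _; set b := qform v (Z ^+ j.+1.*2).
set c := qform v (Z ^+ j.+2.*2); set z := qform _ _; set t := qform v (Z ^+ 1.*2).
move=> a0 b0 c0 z0 t0 IH bac.
have [->|b_neq0] := eqVneq b 0; first by rewrite mulr0 mulr_ge0.
have b_gt0 : 0 < b by rewrite lt_def b_neq0.
rewrite -(ler_pM2r b_gt0) -mulrA -expr2.
apply: (@le_trans _ _ (t * (a * c))); first exact: ler_wpM2l.
by rewrite mulrA [in X in _ <= X]mulrAC ler_wpM2r.
Qed.

(* Substitute for the spectral norm bound: the moments of [Z] at [v] are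
   log-convex, so no diagonalisation of [Z] is needed. *)
Lemma qform_le_of_trace Z v q (eps : R) : Z^T = Z -> 0 <= eps -> (0 < q)%N ->
  \tr (Z ^+ q.*2) <= eps ^+ q.*2 -> `|qform v Z| <= eps * (v^T *m v) 0 0.
Proof.
move=> sZ eps_ge0; case: q => // q _ trZ.
set z := (v^T *m v) 0 0; have z0 : 0 <= z := dot_ge0 v.
have q2 : qform v (Z ^+ 2) ^+ q.+1 <= z ^+ q * qform v (Z ^+ q.+1.*2).
  elim: q {trZ} => [|q IHq]; first by rewrite expr0 mul1r expr1.
  rewrite exprS; apply: le_trans (ler_wpM2l (qform_pow_ge0 v 1 sZ) IHq) _.
  rewrite mulrCA [z ^+ q.+1]exprSr -mulrA; apply: ler_wpM2l; first exact: exprn_ge0.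
  exact: qform_moment_mono.
have q1 : qform v Z ^+ 2 <= z * qform v (Z ^+ 2).
  have := qform_pow_CS v 0 1 sZ; rewrite expr1.
  by rewrite (_ : qform v (Z ^+ 0.*2) = z) // /qform expr0 mulmx1.
have ez0 : 0 <= eps * z by rewrite mulr_ge0.
rewrite -(@ler_pXn2r _ q.+1.*2) ?nnegrE //.
rewrite -[in X in X <= _]mul2n exprM -normrX ger0_norm ?sqr_ge0 //.
apply: (@le_trans _ _ ((z * qform v (Z ^+ 2)) ^+ q.+1)).
  by rewrite ler_pXn2r ?nnegrE ?sqr_ge0 // mulr_ge0 ?(qform_pow_ge0 v 1 sZ).
rewrite exprMn; apply: (@le_trans _ _ (z ^+ q.+1 * (z ^+ q * (z * eps ^+ q.+1.*2)))).
  apply: ler_wpM2l; first exact: exprn_ge0.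
  apply: le_trans q2 _; apply: ler_wpM2l; first exact: exprn_ge0.
  by apply: le_trans (qform_pow_le_trace v q.+1 sZ) _; exact: ler_wpM2l.
by rewrite exprMn [X in _ <= X]mulrC (mulrA (z ^+ q)) -exprSr mulrA -exprD addnn.
Qed.

End Symmetric.

(** * Powers of a symmetric matrix under a rank-one update *)

Section RankOneUpdate.
Variable R : realFieldType.

(** Induction on the right end: it suffices that the old endpoint [e h] stays below the new maximum,
    which is convexity at that point. *)
Lemma convex_seq_le_max (e : nat -> R) h :
  (forall i, (i.+2 <= h)%N -> 2%:R * e i.+1 <= e i + e i.+2) ->
  forall i, (i <= h)%N -> e i <= Num.max (e 0%N) (e h).
Proof.
elim: h => [|h IHh] cvx i ih.
  by move: ih; rewrite leqn0 => /eqP->; rewrite le_max lexx.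
have {}IHh := IHh (fun j jh => cvx j (leqW jh)).
have eh : e h <= Num.max (e 0%N) (e h.+1).
  case: h cvx {ih} IHh => [|h] cvx IHh; first by rewrite le_max lexx.
  have := cvx h (leqnn _); have := IHh h (leqnSn _).
  rewrite !le_max => /orP[] h1 h2; last by apply/orP; right; lra.
  by have [|] := lerP (e h.+1) (e 0%N) => //= h3; lra.
move: ih; rewrite leq_eqVlt => /orP[/eqP->|ih]; first by rewrite le_max lexx orbT.
apply: le_trans (IHh i ih) _; rewrite ge_max eh le_max lexx //.
Qed.

Variable d : nat.

(* Telescoping [A^(m+1) - B^(m+1)] with [A - B = v v^T] produces this sum. *)
Lemma sum_qform_pow_le (A B : 'M[R]_d) (v : 'cV[R]_d) (rho : R) h :
  A^T = A -> B^T = B -> (v^T *m v) 0 0 <= rho ->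
  \sum_(j < h.*2.+1) qform v (A ^+ j) * qform v (B ^+ (h.*2 - j)) <=
  h.*2.+1%:R * rho * (qform v (A ^+ h.*2) + qform v (B ^+ h.*2)).
Proof.
move=> sA sB v_le.
pose al j := qform v (A ^+ j); pose be j := qform v (B ^+ j).
(* The terms of even index, which are nonnegative; those of odd index need not be. *)
pose e i := al i.*2 * be (h - i).*2.
have e_ge0 i : 0 <= e i by rewrite mulr_ge0 ?qform_pow_ge0.
have amgm (x y z : R) : 0 <= x -> 0 <= z -> y ^+ 2 <= x * z -> 2%:R * y <= x + z.
  move=> x0 z0 yxz; have [y0|/ltW y0] := lerP y 0; first by lra.
  rewrite -(@ler_pXn2r _ 2) ?nnegrE ?addr_ge0 ?mulr_ge0 //.
  by have := sqr_ge0 (x - z); lra.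
have prodCS a b a' b' : al (a + b)%N ^+ 2 * be (a' + b')%N ^+ 2 <=
    (al a.*2 * be b'.*2) * (al b.*2 * be a'.*2).
  apply: le_trans (_ : al a.*2 * al b.*2 * (be a'.*2 * be b'.*2) <= _).
    by apply: ler_pM; rewrite ?sqr_ge0 ?qform_pow_CS.
  by rewrite le_eqVlt; apply/orP; left; apply/eqP; ring.
set T := rho * (al h.*2 + be h.*2).
(* AM-GM turns the log-convexity of [e] into convexity, so its two ends dominate; there one factor
   is |v|^2, at most [rho]. *)
have emax i : (i <= h)%N -> e i <= T.
  move=> ih; apply: le_trans (_ : Num.max (e 0%N) (e h) <= _).
    apply: convex_seq_le_max ih => {}i ih; apply: amgm => //.
    have := prodCS i i.+2 (h - i.+2)%N (h - i)%N.
    rewrite /e exprMn (_ : i + i.+2 = i.+1.*2)%N; last by lia.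
    by rewrite (_ : h - i.+2 + (h - i) = (h - i.+1).*2)%N //; lia.
  have [al0 be0] : al 0%N = (v^T *m v) 0 0 /\ be 0%N = (v^T *m v) 0 0.
    by rewrite /al /be /qform !expr0 !mulmx1.
  have [ha hb] : 0 <= al h.*2 /\ 0 <= be h.*2 by split; apply: qform_pow_ge0.
  have v0 := dot_ge0 v.
  rewrite ge_max /e subn0 subnn double0 al0 be0 /T; apply/andP; split; nra.
have -> : h.*2.+1%:R * rho * (qform v (A ^+ h.*2) + qform v (B ^+ h.*2)) =
    \sum_(j < h.*2.+1) T.
  by rewrite sumr_const card_ord -mulrA mulr_natl.
apply: ler_sum => -[j /= jh] _; rewrite -/(al j) -/(be _).
(* A term of odd index is at most the mean of its two even neighbours, again by AM-GM. *)
have [jodd|jeven] := boolP (odd j).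
  have jE : (j = j./2 + j./2.+1)%N by lia.
  have := prodCS j./2 j./2.+1 (h - j./2.+1)%N (h - j./2)%N.
  rewrite -jE (_ : h - j./2.+1 + (h - j./2) = h.*2 - j)%N; last by lia.
  rewrite -exprMn -/(e j./2) -/(e j./2.+1) => /(amgm _ _ _ (e_ge0 _) (e_ge0 _)).
  have := emax j./2; have := emax j./2.+1.
  move=> /(_ ltac:(lia)) h1 /(_ ltac:(lia)) h2; lra.
have -> : al j * be (h.*2 - j)%N = e j./2.
  by rewrite /e; congr (al _ * be _); lia.
by apply: emax; lia.
Qed.

Lemma subrX_telescope (A B : 'M[R]_d) m :
  A ^+ m.+1 - B ^+ m.+1 = \sum_(j < m.+1) A ^+ j *m (A - B) *m B ^+ (m - j).
Proof.
elim: m => [|m IHm]; first by rewrite big_ord1 !expr1 !expr0 mul1mx mulmx1.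
rewrite big_ord_recl expr0 mul1mx subn0.
under eq_bigr do rewrite /= /bump leq0n add1n subSS exprS -mulmxE -!mulmxA.
rewrite -mulmx_sumr; under eq_bigr do rewrite mulmxA.
rewrite -IHm [in LHS]exprS [in X in _ - X]exprS -!mulmxE mulmxBl mulmxBr.
by rewrite [RHS]addrC addrA subrK.
Qed.

Lemma qform_powB_le (A B : 'M[R]_d) (v : 'cV[R]_d) (rho : R) h :
  A^T = A -> B^T = B -> A - B = v *m v^T -> (v^T *m v) 0 0 <= rho ->
  qform v (A ^+ h.*2.+1) - qform v (B ^+ h.*2.+1) <=
  h.*2.+1%:R * rho * (qform v (A ^+ h.*2) + qform v (B ^+ h.*2)).
Proof.
move=> sA sB AB v_le; rewrite -qformB subrX_telescope qform_sum AB.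
by under eq_bigr do rewrite qform_rank1; exact: sum_qform_pow_le.
Qed.

End RankOneUpdate.

(** * Trace moments of sums of independent rank-one matrices *)

Definition Expect (R : numDomainType) (T : finType) (mu : T -> R) (f : T -> R) : R :=
  \sum_t mu t * f t.

Section Expectation.
Variables (R : realFieldType) (T : finType) (mu : T -> R).
Implicit Types f g : T -> R.

Lemma ExpectD f g :
  Expect mu (fun t => f t + g t) = Expect mu f + Expect mu g.
Proof. by rewrite -big_split; apply: eq_bigr => t _; rewrite /= mulrDr. Qed.

Lemma ExpectZ c f : Expect mu (fun t => c * f t) = c * Expect mu f.
Proof. by rewrite mulr_sumr; apply: eq_bigr => t _; rewrite mulrCA. Qed.

Lemma Expect_sum (I : finType) (f : I -> T -> R) :
  Expect mu (fun t => \sum_i f i t) = \sum_i Expect mu (f i).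
Proof. by rewrite exchange_big; apply: eq_bigr => t _; rewrite mulr_sumr. Qed.

Lemma eq_Expect f g : f =1 g -> Expect mu f = Expect mu g.
Proof. by move=> fg; apply: eq_bigr => t _; rewrite fg. Qed.

Hypothesis mu_ge0 : forall t, 0 <= mu t.

Lemma ler_Expect f g : (forall t, f t <= g t) -> Expect mu f <= Expect mu g.
Proof. by move=> fg; apply: ler_sum => t _; rewrite ler_wpM2l. Qed.

Lemma Markov f c d : (forall t, 0 <= f t) -> 0 < c -> Expect mu f <= d * c ->
  Prob mu (fun t => ~ f t <= c) <= d.
Proof.
move=> f_ge0 c_gt0 Ef; rewrite -(ler_pM2r c_gt0); apply: le_trans Ef.
rewrite /Prob mulr_suml /Expect big_mkcond; apply: ler_sum => t _.
case: asboolP => [/negP|_]; last by rewrite mulr_ge0.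
by rewrite -ltNge => /ltW cf; rewrite ler_wpM2l.
Qed.

Lemma Prob_and_ge (P Q : T -> Prop) (a b : R) : \sum_t mu t = 1 ->
  Prob mu (fun t => ~ P t) <= a -> Prob mu (fun t => ~ Q t) <= b ->
  1 - (a + b) <= Prob mu (fun t => P t /\ Q t).
Proof.
move=> mu1 Pa Qb; rewrite lerBlDr -mu1.
apply: (@le_trans _ _ (Prob mu (fun t => P t /\ Q t) +
  (Prob mu (fun t => ~ P t) + Prob mu (fun t => ~ Q t)))); last first.
  by rewrite lerD2l lerD.
rewrite /Prob (big_mkcond (fun t => `[< P t /\ _ >])).
rewrite (big_mkcond (fun t => `[< ~ P t >])) (big_mkcond (fun t => `[< ~ Q t >])).
rewrite -!big_split; apply: ler_sum => t _ /=.
have := mu_ge0 t; case: asboolP => [[p q]|npq]; case: asboolP => p1;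
  case: asboolP => q1; rewrite ?addr0 ?add0r ?lerDl ?addr_ge0 //; try lra.
by case: npq; split; apply: contrapT.
Qed.

Lemma ler_Prob (P Q : T -> Prop) : (forall t, P t -> Q t) ->
  Prob mu P <= Prob mu Q.
Proof.
move=> PQ; rewrite /Prob big_mkcond [leRHS]big_mkcond; apply: ler_sum => t _.
by case: asboolP => [/PQ Qt|_]; case: asboolP.
Qed.

End Expectation.

(** * Product Bernoulli measures *)

Section ProductMeasure.
Variables (R : realFieldType) (I : finType) (p : I -> R).
Implicit Types (x : {ffun I -> bool}) (i : I).

Definition bernoulli_prod x : R := \prod_i (if x i then p i else 1 - p i).

Definition set_bit x i b : {ffun I -> bool} :=
  [ffun j => if j == i then b else x j].

Local Notation nu := bernoulli_prod.

Lemma set_bit_id x i : set_bit x i (x i) = x.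
Proof. by apply/ffunP => j; rewrite ffunE; case: eqP => // ->. Qed.

Lemma set_bit_set x i b c : set_bit (set_bit x i b) i c = set_bit x i c.
Proof. by apply/ffunP => j; rewrite !ffunE; case: eqP. Qed.

Lemma set_bitE x i b : set_bit x i b i = b.
Proof. by rewrite ffunE eqxx. Qed.

(** [set_bit x i b] forgets the old bit [i], so the weight of the other bits factors out and
    flipping that bit exchanges the two halves of the cube. *)
Lemma Expect_resample i (h : {ffun I -> bool} -> R) :
  Expect nu h = Expect nu (fun x =>
    p i * h (set_bit x i true) + (1 - p i) * h (set_bit x i false)).
Proof.
pose nu' x := \prod_(j | j != i) (if x j then p j else 1 - p j).
have nuE x : nu x = (if x i then p i else 1 - p i) * nu' x.
  by rewrite /nu (bigD1 i).
have nu'_set x b : nu' (set_bit x i b) = nu' x.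
  by apply: eq_bigr => j /negPf ji; rewrite ffunE ji.
pose flip x := set_bit x i (~~ x i).
have flipK : involutive flip.
  by move=> x; rewrite /flip set_bit_set set_bitE negbK set_bit_id.
have swap F : (forall x b, F (set_bit x i b) = F x) ->
    \sum_(x : {ffun I -> bool} | ~~ x i) F x =
    \sum_(x : {ffun I -> bool} | x i) F x :> R.
  move=> Fi; rewrite (reindex_inj (inv_inj flipK)) /=.
  by apply: eq_big => [x|x _]; rewrite /flip ?set_bitE ?negbK ?Fi.
pose S b := \sum_(x : {ffun I -> bool} | x i) nu' x * h (set_bit x i b).
have SE b : \sum_(x : {ffun I -> bool} | ~~ x i) nu' x * h (set_bit x i b) = S b.
  by apply: swap => x c; rewrite nu'_set set_bit_set.
rewrite /Expect (bigID (fun x : {ffun I -> bool} => x i)) /=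
  [RHS](bigID (fun x : {ffun I -> bool} => x i)) /=.
(* Both sides equal this value; on the right the two halves contribute it with weights [p i] and
   [1 - p i]. *)
transitivity (p i * S true + (1 - p i) * S false).
  rewrite -(SE false) !mulr_sumr; congr (_ + _); apply: eq_bigr => x xi.
    by rewrite nuE xi -{2}(set_bit_id x i) xi mulrA.
  by rewrite nuE (negPf xi) -{2}(set_bit_id x i) (negPf xi) mulrA.
have -> : \sum_(x : {ffun I -> bool} | x i) nu x *
    (p i * h (set_bit x i true) + (1 - p i) * h (set_bit x i false)) =
    p i * (p i * S true + (1 - p i) * S false).
  rewrite /S !mulr_sumr -big_split mulr_sumr /=; apply: eq_bigr => x xi.
  by rewrite nuE xi; ring.
have -> : \sum_(x : {ffun I -> bool} | ~~ x i) nu x *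
    (p i * h (set_bit x i true) + (1 - p i) * h (set_bit x i false)) =
    (1 - p i) * (p i * S true + (1 - p i) * S false).
  rewrite -!SE !mulr_sumr -big_split mulr_sumr /=; apply: eq_bigr => x xi.
  by rewrite nuE (negPf xi); ring.
by ring.
Qed.

Lemma Expect_bernoulli_prod_set (S : {set I}) :
  Expect nu (fun x => \prod_(i in S) (x i)%:R) = \prod_(i in S) p i.
Proof.
transitivity (\sum_(x : {ffun I -> bool}) \prod_i ((if x i then p i else 1 - p i) *
    (if i \in S then (x i)%:R else 1))).
  by apply: eq_bigr => x _; rewrite big_split /= -big_mkcond.
rewrite -(bigA_distr_bigA (fun i (b : bool) => (if b then p i else 1 - p i) *
    (if i \in S then b%:R else 1))) /= [RHS]big_mkcond.
apply: eq_bigr => i _; rewrite big_bool /=.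
by case: (i \in S); rewrite ?mulr1 ?mulr0 ?addr0 // addrC subrK.
Qed.

Hypothesis p01 : forall i, 0 <= p i <= 1.

Lemma bernoulli_prod_ge0 x : 0 <= nu x.
Proof.
apply: prodr_ge0 => i _; have /andP[p0 p1] := p01 i.
by case: (x i); rewrite ?subr_ge0.
Qed.

End ProductMeasure.

(** * Low-degree functions under k-wise independence *)

Section KwiseIndependence.
Variables (R : realFieldType) (I : finType) (p : I -> R) (k : nat).
Variable mu : {ffun I -> bool} -> R.
Hypothesis mu_kwise : kwise_independent k p mu.
Local Notation nu := (bernoulli_prod p).
Implicit Types f g : {ffun I -> bool} -> R.

Lemma Expect_kwise_set (S : {set I}) : (#|S| <= k)%N ->
  Expect mu (fun x : {ffun I -> bool} => \prod_(i in S) (x i)%:R) =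
  \prod_(i in S) p i.
Proof.
move=> Sk; have := mu_kwise [ffun=> true] Sk.
under [in RHS]eq_bigr do rewrite ffunE.
move=> <-; rewrite /Expect /Prob [RHS]big_mkcond; apply: eq_bigr => x _.
case: asboolP => [xS|nxS].
  by rewrite big1 ?mulr1 // => i iS; rewrite xS // ffunE.
have [xS|] := boolP [forall i in S, x i].
  by case: nxS => i iS; rewrite ffunE; apply: (forall_inP xS).
rewrite negb_forall_in => /exists_inP[i iS /negPf xi].
by rewrite (bigD1 i) //= xi mul0r mulr0.
Qed.

(* Semantic form of "[f] is a polynomial of degree at most [m] in the bits". *)
Definition fooled m f := forall S : {set I}, (#|S| + m <= k)%N ->
  Expect mu (fun x => (\prod_(i in S) (x i)%:R) * f x) =
  Expect nu (fun x => (\prod_(i in S) (x i)%:R) * f x).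

Lemma fooledE f : fooled k f -> Expect mu f = Expect nu f.
Proof.
move/(_ finset.set0); rewrite cards0 => /(_ (leqnn _)).
have E1 (x : {ffun I -> bool}) :
    (\prod_(i in (finset.set0 : {set I})) (x i)%:R) * f x = f x.
  by rewrite finset.big_set0 mul1r.
by rewrite (eq_Expect mu E1) (eq_Expect nu E1).
Qed.

Lemma eq_fooled m f g : f =1 g -> fooled m f -> fooled m g.
Proof.
by move=> fg ff S Sk; rewrite -!(eq_Expect _ (fun x => congr1 _ (fg x))) ff.
Qed.

Lemma fooledW m n f : (m <= n)%N -> fooled m f -> fooled n f.
Proof. by move=> mn ff S Sk; apply: ff; apply: leq_trans Sk; rewrite leq_add2l. Qed.

(** The base case, where independence enters: what remains is the mean of a product of at most [k]
    bits. The rules below are formal closure properties. *)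
Lemma fooled_cst m c : fooled m (fun=> c).
Proof.
move=> S Sk; under eq_Expect do rewrite mulrC.
under [RHS]eq_Expect do rewrite mulrC.
rewrite !ExpectZ Expect_bernoulli_prod_set Expect_kwise_set //.
by apply: leq_trans Sk; rewrite leq_addr.
Qed.

Lemma fooledD m f g : fooled m f -> fooled m g -> fooled m (fun x => f x + g x).
Proof.
move=> ff fg S Sk; under eq_Expect do rewrite mulrDr.
under [RHS]eq_Expect do rewrite mulrDr.
by rewrite !ExpectD ff ?fg.
Qed.

Lemma fooledZ m c f : fooled m f -> fooled m (fun x => c * f x).
Proof.
move=> ff S Sk; under eq_Expect do rewrite mulrCA.
under [RHS]eq_Expect do rewrite mulrCA.
by rewrite !ExpectZ ff.
Qed.

Lemma fooled_sum m (J : finType) (F : J -> {ffun I -> bool} -> R) :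
  (forall j, fooled m (F j)) -> fooled m (fun x => \sum_j F j x).
Proof.
move=> fF S Sk; under eq_Expect do rewrite mulr_sumr.
under [RHS]eq_Expect do rewrite mulr_sumr.
by rewrite !Expect_sum; apply: eq_bigr => j _; rewrite fF.
Qed.

(** Bits are idempotent, so the new factor is absorbed into [i |: S], which has at most one more
    element; the degree [m.+1] pays for it. *)
Lemma fooled_bit m i f : fooled m f -> fooled m.+1 (fun x => (x i)%:R * f x).
Proof.
move=> ff S Sk.
have E1 (x : {ffun I -> bool}) : (\prod_(j in S) (x j)%:R) * ((x i)%:R * f x) =
    (\prod_(j in i |: S) (x j)%:R) * f x.
  rewrite mulrA; congr (_ * _); have [iS|iS] := boolP (i \in S).
    rewrite (_ : i |: S = S)%SET; last by apply/finset.setUidPr; rewrite finset.sub1set.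
    by rewrite (bigD1 i iS) /= mulrAC -natrM mulnb andbb.
  by rewrite finset.big_setU1 //= mulrC.
rewrite (eq_Expect mu E1) (eq_Expect nu E1) ff //.
by move: Sk; rewrite cardsU1; case: (i \in S); lia.
Qed.

End KwiseIndependence.

(** * The recursion on trace moments *)

Section TraceMoments.
Variables (R : realFieldType) (I : finType) (d : nat).
Variables (p : I -> R) (v : I -> 'cV[R]_d).

Definition centered_sum (x : {ffun I -> bool}) : 'M[R]_d :=
  \sum_i ((x i)%:R - p i) *: (v i *m (v i)^T).

Local Notation Z := centered_sum.
Local Notation nu := (bernoulli_prod p).
Local Notation M := (\sum_i p i *: (v i *m (v i)^T)).

Lemma centered_sum_sym x : (Z x)^T = Z x.
Proof.
rewrite /Z raddf_sum; apply: eq_bigr => i _.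
by rewrite /= linearZ /= trmx_mul trmxK.
Qed.

(** Every entry of [Z x ^+ m] is fooled at degree [m], by induction: one more factor [Z x] is affine
    in the bits and raises the degree by one. *)
Lemma fooled_trace_pow k mu m : kwise_independent k p mu ->
  fooled p k mu m (fun x => \tr (Z x ^+ m)).
Proof.
move=> mu_kwise; apply: fooled_sum => a.
elim: m {1}a => [|m IHm] b; first exact: fooled_cst.
pose F (x : {ffun I -> bool}) :=
  \sum_j \sum_i ((x i)%:R * ((v i *m (v i)^T) b j * (Z x ^+ m) j a)
  + (- p i * (v i *m (v i)^T) b j) * (Z x ^+ m) j a).
apply: (@eq_fooled _ _ _ _ _ _ F) => [x|].
  rewrite exprS -mulmxE mxE; apply: eq_bigr => j _.
  rewrite summxE mulr_suml; apply: eq_bigr => i _.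
  by rewrite [in RHS]mxE; ring.
apply: fooled_sum => j; apply: fooled_sum => i; apply: fooledD.
  by apply: fooled_bit; apply: fooledZ; exact: IHm.
by apply: fooledZ; apply: fooledW (leqnSn m) _; exact: IHm.
Qed.

Hypothesis p01 : forall i, 0 <= p i <= 1.
Variable rho : R.
Hypothesis rho_ge0 : 0 <= rho.
Hypothesis v_le : forall i, p i = 1 \/ ((v i)^T *m v i) 0 0 <= rho.

Lemma trace_centered_sumM x A :
  \tr (Z x *m A) = \sum_i ((x i)%:R - p i) * qform (v i) A.
Proof.
rewrite /Z mulmx_suml raddf_sum; apply: eq_bigr => i _.
by rewrite -scalemxAl /= linearZ /= mxtrace_rank1.
Qed.

Lemma centered_sum_flip x i :
  Z (set_bit x i true) - Z (set_bit x i false) = v i *m (v i)^T.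
Proof.
rewrite /Z -sumrB (bigD1 i) //= !ffunE eqxx big1 ?addr0.
  by rewrite -scalerBl opprB subr0 subrK scale1r.
by move=> j /negPf ji; rewrite !ffunE ji subrr.
Qed.

Lemma bit_moment_le i h :
  Expect nu (fun x => ((x i)%:R - p i) * qform (v i) (Z x ^+ h.*2.+1)) <=
  h.*2.+1%:R * rho *
    Expect nu (fun x => ((x i)%:R + p i) * qform (v i) (Z x ^+ h.*2)).
Proof.
have nu_ge0 := bernoulli_prod_ge0 p01.
have /andP[p0 p1] := p01 i.
have s_ge0 : 0 <= h.*2.+1%:R * rho by rewrite mulr_ge0.
(* With this weight, resampling gives both values of bit [i] the factor [p i * (1 - p i)], as in the
   difference on the left; and [w (x i)] is at most [x i + p i]. *)
pose w (b : bool) := if b then 1 - p i else p i.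
apply: (@le_trans _ _ (h.*2.+1%:R * rho *
    Expect nu (fun x => w (x i) * qform (v i) (Z x ^+ h.*2)))); last first.
  apply: ler_wpM2l => //; apply: ler_Expect => // x.
  apply: ler_wpM2r; first by rewrite qform_pow_ge0 ?centered_sum_sym.
  by rewrite /w; case: (x i) => /=; lra.
rewrite (Expect_resample p i) [in leRHS](Expect_resample p i) -ExpectZ.
apply: ler_Expect => // x; rewrite !set_bitE /w /=.
set A := Z (set_bit x i true); set B := Z (set_bit x i false).
(* If [p i = 1] the bit is deterministic and both sides vanish. *)
have [->|vle] := v_le i; first by rewrite subrr !(mul0r, mulr0, addr0).
have := qform_powB_le h (centered_sum_sym _) (centered_sum_sym _)
  (centered_sum_flip x i) vle.
rewrite -/A -/B; set a := qform _ _; set b := qform _ _; set s := _ * rho.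
set a' := qform _ (A ^+ _); set b' := qform _ (B ^+ _) => ab.
have -> : p i * ((1 - p i) * a) + (1 - p i) * ((0 - p i) * b) =
  p i * (1 - p i) * (a - b) by ring.
have -> : s * (p i * ((1 - p i) * a') + (1 - p i) * (p i * b')) =
  p i * (1 - p i) * (s * (a' + b')) by ring.
by apply: ler_wpM2l => //; rewrite mulr_ge0 // subr_ge0.
Qed.

Local Notation mom m := (Expect nu (fun x => \tr (Z x ^+ m))).

Lemma moment_le h : mom h.*2.+2 <= h.*2.+1%:R * rho *
  \sum_i Expect nu (fun x => ((x i)%:R + p i) * qform (v i) (Z x ^+ h.*2)).
Proof.
under eq_Expect do rewrite exprS -mulmxE trace_centered_sumM.
by rewrite Expect_sum mulr_sumr; apply: ler_sum => i _; exact: bit_moment_le.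
Qed.

(** The recursion starts at the second moment: the zeroth is the dimension [d], for a graph the
    number of edges, whereas [N] will be the number of vertices. *)
Lemma moment2_le N : \sum_i p i * ((v i)^T *m v i) 0 0 <= N ->
  mom 2 <= 2%:R * rho * N.
Proof.
move=> MN; apply: le_trans (moment_le 0) _; rewrite mul1r [2%:R * rho]mulrC -mulrA.
apply: ler_wpM2l => //; apply: le_trans (ler_wpM2l _ MN) => //.
rewrite mulr_sumr; apply: ler_sum => i _.
rewrite (Expect_resample p i).
under eq_Expect do rewrite !set_bitE expr0 /qform mulmx1.
have Ecst c : Expect nu (fun=> c) = c.
  rewrite -[in LHS](mulr1 c) ExpectZ -[RHS]mulr1; congr (_ * _).
  have := Expect_bernoulli_prod_set p finset.set0; rewrite finset.big_set0 => e.
  rewrite -[RHS]e.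
  by apply: eq_Expect => x; rewrite finset.big_set0.
rewrite Ecst le_eqVlt; apply/orP; left; apply/eqP => /=; ring.
Qed.

Hypothesis M_le : forall u : 'cV[R]_d, qform u M <= (u^T *m u) 0 0.

(** The odd moment is eliminated between [moment_le] and the positivity of the trace of
    [(Z - c)^2 Z^(2h)], where [c = (2h+1) rho]. *)
Lemma moment_step h : mom h.*2.+2 <=
  ((h.*2.+1%:R * rho) ^+ 2 + 4%:R * (h.*2.+1%:R * rho)) * mom h.*2.
Proof.
have nu_ge0 := bernoulli_prod_ge0 p01.
have := moment_le h; set c := _ * rho; rewrite -Expect_sum.
have c_ge0 : 0 <= c by rewrite mulr_ge0.
have : Expect nu (fun x => \sum_i ((x i)%:R + p i) * qform (v i) (Z x ^+ h.*2))
    <= mom h.*2.+1 + 2%:R * mom h.*2.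
  rewrite -ExpectZ -ExpectD; apply: ler_Expect => // x.
  (* Writing [x + p] as [(x - p) + 2 p] separates [Z] from [M], and [M] is then bounded by the
     identity. *)
  have -> : \sum_i ((x i)%:R + p i) * qform (v i) (Z x ^+ h.*2) =
      \tr (Z x ^+ h.*2.+1) + 2%:R * \tr (M *m Z x ^+ h.*2).
    rewrite exprS -mulmxE trace_centered_sumM mulmx_suml raddf_sum mulr_sumr.
    rewrite -big_split; apply: eq_bigr => i _ /=.
    by rewrite -scalemxAl /= linearZ /= mxtrace_rank1; ring.
  rewrite lerD2l; apply: ler_wpM2l => //.
  have := @mxtrace_mulmx_pow_ge0 _ _ (1%:M - M) _ h (centered_sum_sym x).
  rewrite mulmxBl mul1mx raddfB /= subr_ge0; apply => u.
  by rewrite qformB subr_ge0 {2}/qform mulmx1; exact: M_le.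
have : 2%:R * c * mom h.*2.+1 <= mom h.*2.+2 + c ^+ 2 * mom h.*2.
  rewrite -!ExpectZ -ExpectD; apply: ler_Expect => // x.
  have sC : (Z x - c%:M)^T = Z x - c%:M.
    by rewrite raddfB /= centered_sum_sym tr_scalar_mx.
  have : 0 <= \tr ((Z x - c%:M) *m (Z x - c%:M) *m Z x ^+ h.*2).
    apply: mxtrace_mulmx_pow_ge0; first exact: centered_sum_sym.
    by move=> u; have := qform_pow_ge0 u 1 sC; rewrite expr2 -mulmxE.
  have -> : (Z x - c%:M) *m (Z x - c%:M) *m Z x ^+ h.*2 =
      Z x ^+ h.*2.+2 - (2%:R * c) *: Z x ^+ h.*2.+1 + c ^+ 2 *: Z x ^+ h.*2.
    rewrite mulmxBl !mulmxBr mul_mx_scalar !mul_scalar_mx.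
    rewrite !mulmxBl -!scalemxAl mul_scalar_mx scalerA -expr2 mulmxE -expr2.
    rewrite -exprD -exprS add2n opprB mulr_natl mulr2n scalerDl opprD.
    by rewrite addrA addrAC !addrA.
  by rewrite mxtraceD raddfB /= !mxtraceZ; lra.
set a2 := mom h.*2.+2; set a1 := mom h.*2.+1; set a0 := mom h.*2.
set S := Expect _ _ => h1 h2 h3.
have h4 : c * S <= c * (a1 + 2 * a0) by rewrite ler_wpM2l.
by lra.
Qed.

(** Each step multiplies by [c^2 + 4 c] with [c <= 2 q rho <= 1], hence by at most [5 (2 q rho)];
    the second moment provides [N] and the first such factor. *)
Lemma moment_bound N q : \sum_i p i * ((v i)^T *m v i) 0 0 <= N ->
  (0 < q)%N -> q.*2%:R * rho <= 1 ->
  mom q.*2 <= N * (5%:R * (q.*2%:R * rho)) ^+ q.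
Proof.
move=> MN q_gt0 k_le; set b := 5%:R * _.
have krho_ge0 : 0 <= q.*2%:R * rho by rewrite mulr_ge0.
have N_ge0 : 0 <= N.
  apply: le_trans MN; apply: sumr_ge0 => i _.
  by have /andP[p0 _] := p01 i; rewrite mulr_ge0 ?dot_ge0.
have b_ge0 : 0 <= b by rewrite mulr_ge0.
suff H h : (h < q)%N -> mom h.+1.*2 <= N * b ^+ h.+1.
  by have := H q.-1; rewrite prednK // => /(_ (leqnn q)).
elim: h => [|h IHh] hq.
  apply: le_trans (moment2_le MN) _; rewrite expr1 mulrC; apply: ler_wpM2l => //.
  have : 2%:R * rho <= q.*2%:R * rho.
    by rewrite ler_wpM2r // ler_nat; lia.
  by rewrite /b; lra.
have m_ge0 : 0 <= mom h.+1.*2.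
  apply: sumr_ge0 => x _; rewrite mulr_ge0 ?bernoulli_prod_ge0 //.
  by rewrite mxtrace_pow_ge0 ?centered_sum_sym.
apply: le_trans (moment_step h.+1) _.
rewrite [b ^+ _]exprSr [leRHS]mulrA [leLHS]mulrC.
apply: (le_trans (ler_wpM2l m_ge0 (_ : _ <= b))).
  set c := _%:R * rho.
  have cq : c <= q.*2%:R * rho by apply: ler_wpM2r => //; rewrite ler_nat; lia.
  have c_ge0 : 0 <= c by rewrite mulr_ge0.
  have c2 : c ^+ 2 <= c by rewrite expr2 ler_piMl // (le_trans cq).
  by rewrite /b; move: (q.*2%:R * rho) cq => K; move: c c_ge0 c2 => c; lra.
by apply: ler_wpM2r => //; apply: IHh; apply: ltnW.
Qed.

End TraceMoments.

(** * The projection attached to a graph *)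

Lemma mulmx_col (R : pzSemiRingType) (m n r : nat) (A : 'M[R]_(m, n))
    (B : 'M[R]_(n, r)) j : A *m col j B = col j (A *m B).
Proof. by rewrite !colE mulmxA. Qed.

Section GramProjection.
Variables (R : realFieldType) (n m : nat) (Q : 'M[R]_(n, m)).
Let L := Q *m Q^T.
Let P := mp_pinv L.

Definition gram_proj : 'M[R]_m := Q^T *m P *m Q.

Lemma gram_eq0 (a b : nat) (A : 'M[R]_(a, b)) : A *m A^T = 0 -> A = 0.
Proof.
move=> AA; have := mxtrace_gram A; rewrite AA mxtrace0 => /esym/psumr_eq0P A0.
apply/matrixP => i j; rewrite mxE; apply/eqP; rewrite -sqrf_eq0; apply/eqP.
have /psumr_eq0P -> // : \sum_j A i j ^+ 2 = 0.
  by apply: A0 => // l _; apply: sumr_ge0 => r _; rewrite sqr_ge0.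
by move=> l _; rewrite sqr_ge0.
Qed.

(** As [L] is symmetric, the transpose of [P] satisfies the same Penrose equations, and these have a
    unique solution. *)
Lemma mp_pinv_gram_sym : P^T = P.
Proof.
have [LPL PLP LP PL] := penrose_mp_pinv L; rewrite -/P in LPL PLP LP PL.
have sL : L^T = L by rewrite trmx_mul trmxK.
clearbody P; clearbody L; apply: (@penrose_unique _ _ _ L); last by split.
have LPt : L *m P^T = P *m L by rewrite -[RHS]PL trmx_mul sL.
have PtL : P^T *m L = L *m P by rewrite -[RHS]LP trmx_mul sL.
split; [| |by rewrite LPt|by rewrite PtL].
- by rewrite -[RHS]sL -[in RHS]LPL !trmx_mul sL mulmxA.
- by rewrite -[in RHS]PLP !trmx_mul sL mulmxA.
Qed.

(** The difference of the two sides is [(L P - 1) Q], whose Gram matrix contains the factor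
    [(L P - 1) L = 0]. *)
Lemma mulmx_gram_proj : Q *m gram_proj = Q.
Proof.
have [LPL _ _ _] := penrose_mp_pinv L; rewrite -/P in LPL.
apply/eqP; rewrite -subr_eq0; apply/eqP.
have -> : Q *m gram_proj - Q = (L *m P - 1%:M) *m Q.
  by rewrite mulmxBl mul1mx /gram_proj !mulmxA.
apply: gram_eq0; rewrite trmx_mul mulmxA -(mulmxA _ Q) -/L.
by rewrite mulmxBl mul1mx LPL subrr mul0mx.
Qed.

Lemma gram_proj_sym : gram_proj^T = gram_proj.
Proof. by rewrite /gram_proj !trmx_mul trmxK mp_pinv_gram_sym mulmxA. Qed.

Lemma gram_proj_idem : gram_proj *m gram_proj = gram_proj.
Proof. by rewrite {1}/gram_proj -mulmxA mulmx_gram_proj. Qed.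

Lemma gram_projE j : gram_proj j j = qform (col j Q) P.
Proof.
rewrite qform_dot /gram_proj -mulmxA mxE; apply: eq_bigr => i _; rewrite !mxE.
by congr (_ * _); apply: eq_bigr => l _; rewrite !mxE.
Qed.

Lemma gram_proj_diag j :
  ((col j gram_proj)^T *m col j gram_proj) 0 0 = gram_proj j j.
Proof.
move: gram_proj gram_proj_idem gram_proj_sym => T TT sT.
by rewrite -[in RHS]TT dotE [RHS]mxE; apply: eq_bigr => i _; rewrite -{3}sT !mxE.
Qed.

(** The diagonal entry is the squared norm of column [j] of the projection; if that column were
    zero, multiplying it by [Q] would give [col j Q = 0]. *)
Lemma gram_proj_diag_gt0 j : col j Q != 0 -> 0 < gram_proj j j.
Proof.
move=> Qj; rewrite lt_def -gram_proj_diag dot_ge0 andbT.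
apply: contra Qj => /eqP pj0; suff pj : col j gram_proj = 0.
  by rewrite -mulmx_gram_proj -mulmx_col pj mulmx0.
have : (col j gram_proj)^T *m (col j gram_proj)^T^T = 0.
  by rewrite trmxK; apply/matrixP => a b; rewrite !ord1 pj0 mxE.
by move/gram_eq0/(congr1 trmx); rewrite trmxK trmx0.
Qed.

Lemma qform_gram_proj_le u : qform u gram_proj <= (u^T *m u) 0 0.
Proof.
move: gram_proj gram_proj_idem gram_proj_sym => T TT sT.
have := dot_ge0 (u - T *m u).
have -> : (u - T *m u)^T = u^T - u^T *m T by rewrite linearB /= trmx_mul sT.
rewrite mulmxBl !mulmxBr -!mulmxA [T *m (T *m u)]mulmxA TT subrr subr0.
by rewrite mxE [X in _ + X]mxE subr_ge0 /qform mulmxA.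
Qed.

(** By cyclicity the trace is that of the orthogonal projection [P L] on the vertex space, and
    [1 - P L] is its own Gram matrix. *)
Lemma mxtrace_gram_proj_le : \tr gram_proj <= n%:R.
Proof.
have [LPL PLP _ PL] := penrose_mp_pinv L; rewrite -/P in LPL PLP PL.
have -> : \tr gram_proj = \tr (P *m L).
  by rewrite /gram_proj -mulmxA mxtrace_mulC -mulmxA.
have -> : n%:R = \tr (1%:M : 'M[R]_n) by rewrite mxtrace1.
rewrite -subr_ge0 -raddfB /=; set T := 1%:M - _.
have -> : T = T *m T^T.
  rewrite /T raddfB /= PL trmx1 mulmxBr mulmx1 mulmxBl mul1mx.
  by rewrite (mulmxA (P *m L)) PLP subrr subr0.
rewrite mxtrace_gram.
by apply: sumr_ge0 => i _; apply: sumr_ge0 => j _; rewrite sqr_ge0.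
Qed.

Lemma sum_col_gram_proj :
  \sum_j col j gram_proj *m (col j gram_proj)^T = gram_proj.
Proof.
move: gram_proj gram_proj_idem gram_proj_sym => T TT sT.
rewrite -[RHS]TT; apply/matrixP => a b; rewrite summxE mxE.
by apply: eq_bigr => j _; rewrite -{4}sT mxE big_ord1 !mxE.
Qed.

End GramProjection.

(** * The Laplacian as a sum over edges *)

Definition incidence (R : nzRingType) (n : nat) (e : 'I_n * 'I_n) : 'cV[R]_n :=
  delta_mx e.1 0 - delta_mx e.2 0.

Lemma laplacianE (R : comNzRingType) (n : nat) (G : wgraph R n) :
  laplacian G =
  \sum_(e in edges G) weight G e *: (incidence R e *m (incidence R e)^T).
Proof.
pose ind (P : bool) : R := P%:R.
(* Both orientations of each stored edge are summed; the two conditionals of [adjacency] exclude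
   each other because [e.1 < e.2]. *)
have adjE i j : adjacency G i j = \sum_(e in edges G) weight G e *
    (ind (i == e.1) * ind (j == e.2) + ind (i == e.2) * ind (j == e.1)).
  have pick a b :
      \sum_(e in edges G) weight G e * (ind (a == e.1) * ind (b == e.2)) =
      if (a, b) \in edges G then weight G (a, b) else 0.
    have other e : e != (a, b) -> weight G e * (ind (a == e.1) * ind (b == e.2)) = 0.
      case: e => c d; rewrite xpair_eqE negb_and.
      rewrite [c == a]eq_sym [d == b]eq_sym /ind /=.
      by case: (a == c) => //= [/negPf->|_]; rewrite ?mul0r ?mulr0.
    case: ifPn => abE; last first.
      by apply: big1 => e eE; apply: other; apply: contra abE => /eqP<-.
    rewrite (bigD1 (a, b)) //= !eqxx /ind !mulr1 big1 ?addr0 // => e /andP[_].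
    exact: other.
  under eq_bigr do rewrite mulrDr [X in _ + _ * X]mulrC.
  rewrite big_split /= !pick mxE.
  case: ifPn => [ijE|_]; last by rewrite add0r.
  case: ifPn => [jiE|_]; last by rewrite addr0.
  by have := edges_lt ijE; have := edges_lt jiE => /=; lia.
have degE i : \sum_j adjacency G i j = \sum_(e in edges G) weight G e *
    (ind (i == e.1) + ind (i == e.2)).
  under eq_bigr do rewrite adjE.
  rewrite exchange_big; apply: eq_bigr => e _; rewrite -mulr_sumr; congr (_ * _).
  have one (a : 'I_n) : \sum_j ind (j == a) = 1.
    by rewrite (bigD1 a) //= eqxx /ind big1 ?addr0 // => j /negPf->.
  by rewrite big_split /= -!mulr_sumr !one !mulr1.
apply/matrixP => i j; rewrite !mxE degE -/(adjacency G) summxE.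
have -> : (if (i, j) \in edges G then weight G (i, j) else
    if (j, i) \in edges G then weight G (j, i) else 0) = adjacency G i j.
  by rewrite mxE.
rewrite adjE -sumrMnl -sumrB; apply: eq_bigr => e eE.
have lt12 := edges_lt eE.
rewrite !mxE big_ord1 !mxE !eqxx !andbT /ind.
have [->|ij] := eqVneq i j.
  rewrite mulr1n; have [->|] := eqVneq j e.1; have [|] := eqVneq _ e.2 => //=.
  - by move=> e12; rewrite e12 ltnn in lt12.
  - by move=> _; ring.
  - by move=> _ _; ring.
  - by move=> _ _; ring.
rewrite mulr0n; have [ie1|] := eqVneq i e.1; have [je1|] := eqVneq j e.1;
  have [ie2|] := eqVneq i e.2; have [je2|] := eqVneq j e.2 => //=;
  try by move=> *; ring.
all: by case/eqP: ij; congruence.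
Qed.

(** * Edge sampling in whitened coordinates *)

Section Sparsify.
Variables (R : realType) (n : nat) (G : wgraph R n) (k : nat) (eps delta : R).
Hypothesis w_gt0 : positive_weights G.
Local Notation E := (edge_type G).
Local Notation s := (sparsify_s n k eps delta).
Local Notation p i :=
  (sparsify_p G (eff_resistance G) k eps delta (val (i : E))).
Hypothesis s_gt0 : 0 < s.

Definition edge_col (i : E) : 'cV[R]_n :=
  Num.sqrt (weight G (val i)) *: incidence R (val i).

Definition wincidence : 'M[R]_(n, #|{: E}|) :=
  \matrix_(a, j) edge_col (enum_val j) a 0.

Local Notation Q := wincidence.
Local Notation Pi := (gram_proj Q).
Local Notation lev i := (Pi (enum_rank i) (enum_rank i)).

Lemma col_wincidence i : col (enum_rank i) Q = edge_col i.
Proof. by apply/colP => a; rewrite mxE mxE enum_rankK. Qed.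

Lemma edge_colM (i : E) : edge_col i *m (edge_col i)^T =
  weight G (val i) *: (incidence R (val i) *m (incidence R (val i))^T).
Proof.
rewrite /edge_col linearZ /= -scalemxAl -scalemxAr scalerA -expr2 sqr_sqrtr //.
by apply/ltW/w_gt0; exact: valP.
Qed.

Lemma sum_edge_type (V : nmodType) (F : 'I_n * 'I_n -> V) :
  \sum_(e in edges G) F e = \sum_(i : E) F (val i).
Proof. exact: big_sub. Qed.

Lemma laplacian_wincidence : laplacian G = Q *m Q^T.
Proof.
rewrite laplacianE sum_edge_type.
under eq_bigr do rewrite -edge_colM.
apply/matrixP => a b; rewrite summxE mxE.
rewrite [RHS](reindex _ (onW_bij _ (@enum_rank_bij E))).
by apply: eq_bigr => i _; rewrite !mxE enum_rankK big_ord1 !mxE.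
Qed.

Lemma lev_eff_resistance i :
  lev i = weight G (val i) * eff_resistance G (val i).
Proof.
rewrite gram_projE col_wincidence -laplacian_wincidence qform_scalev sqr_sqrtr //.
by apply/ltW/w_gt0; exact: valP.
Qed.

(** An edge has distinct endpoints and positive weight, so its column is nonzero. This makes every
    [p i] positive and licenses the divisions by it. *)
Lemma lev_gt0 i : 0 < lev i.
Proof.
apply: gram_proj_diag_gt0; rewrite col_wincidence /edge_col scaler_eq0 negb_or.
rewrite sqrtr_eq0 -ltNge w_gt0 ?(valP i) //=.
apply/eqP => /colP/(_ (val i).1); rewrite !mxE !eqxx /=.
have := @edges_lt _ _ G _ (valP i); rewrite ltn_neqAle => /andP[/negPf ne _].
by rewrite (_ : (_ == _) = false) // subr0 => /eqP; rewrite oner_eq0.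
Qed.

Lemma sparsify_pE i : p i = Num.min 1 (lev i * s).
Proof. by rewrite lev_eff_resistance. Qed.

Lemma sparsify_p_gt0 i : 0 < p i.
Proof. by rewrite sparsify_pE lt_min ltr01 mulr_gt0 ?lev_gt0. Qed.

Lemma sparsify_p01 i : 0 <= p i <= 1.
Proof. by rewrite (ltW (sparsify_p_gt0 i)) /= ge_min lexx. Qed.

(** An inequality form of Foster's theorem on the sum of the [w_e R_e]. *)
Lemma sum_lev_le : \sum_i lev i <= n%:R.
Proof.
apply: le_trans (mxtrace_gram_proj_le Q); rewrite /mxtrace.
by rewrite [leRHS](reindex _ (onW_bij _ (@enum_rank_bij E))).
Qed.

Lemma sum_sparsify_p_le : \sum_i p i <= n%:R * s.
Proof.
apply: le_trans (ler_wpM2r (ltW s_gt0) sum_lev_le); rewrite mulr_suml.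
by apply: ler_sum => i _; rewrite sparsify_pE ge_min lexx orbT.
Qed.

(* Whitened edge vectors; taking columns of [Pi] avoids a square root of [L^+]. *)
Definition iso_vec (i : E) : 'cV[R]_#|{: E}| :=
  (Num.sqrt (p i))^-1 *: col (enum_rank i) Pi.

Lemma iso_vecM i : iso_vec i *m (iso_vec i)^T =
  (p i)^-1 *: (col (enum_rank i) Pi *m (col (enum_rank i) Pi)^T).
Proof.
rewrite /iso_vec linearZ /= -scalemxAl -scalemxAr scalerA -expr2 exprVn sqr_sqrtr //.
by rewrite ltW ?sparsify_p_gt0.
Qed.

Lemma iso_vec_dot i : ((iso_vec i)^T *m iso_vec i) 0 0 = (p i)^-1 * lev i.
Proof.
rewrite -qform1 qform_scalev qform1 exprVn sqr_sqrtr ?gram_proj_diag //.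
by rewrite ltW ?sparsify_p_gt0.
Qed.

(** The squared norm is [lev i / p i], exactly [1 / s] when the minimum defining [p i] is
    [lev i * s]. *)
Lemma iso_vec_le i : p i = 1 \/ ((iso_vec i)^T *m iso_vec i) 0 0 <= s^-1.
Proof.
rewrite iso_vec_dot; have [p1|p1] := leP 1 (lev i * s).
  by left; rewrite sparsify_pE; apply/min_idPl.
right; rewrite sparsify_pE (min_idPr (ltW p1)) invfM mulrAC mulVf ?mul1r //.
by rewrite gt_eqF ?lev_gt0.
Qed.

Lemma sum_iso_vec_dot : \sum_i p i * ((iso_vec i)^T *m iso_vec i) 0 0 <= n%:R.
Proof.
apply: le_trans sum_lev_le; apply: ler_sum => i _.
by rewrite iso_vec_dot mulrA divff ?mul1r // gt_eqF ?sparsify_p_gt0.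
Qed.

Lemma sum_iso_vec : \sum_i p i *: (iso_vec i *m (iso_vec i)^T) = Pi.
Proof.
under eq_bigr => i _ do
  rewrite iso_vecM scalerA divff ?scale1r ?gt_eqF ?sparsify_p_gt0 //.
rewrite -[RHS]sum_col_gram_proj.
by rewrite [RHS](reindex _ (onW_bij _ (@enum_rank_bij E))).
Qed.

Local Notation Z := (centered_sum (fun i : E => p i) iso_vec).
Local Notation H x := (sparsify (eff_resistance G) k eps delta x).

(** [Q Pi = Q] sends each column of [Pi] back to its edge vector, and the factor [1 / p i] in
    [iso_vecM] is the reweighting of the sampled edges. *)
Lemma laplacian_sparsifyB x :
  laplacian (H x) - laplacian G = Q *m Z x *m Q^T.
Proof.
have -> : laplacian (H x) =
    \sum_(i : E) ((x i)%:R / p i) *: (edge_col i *m (edge_col i)^T).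
  rewrite laplacianE big_imset /=; last by move=> i j _ _; exact: val_inj.
  rewrite big_mkcond /=; apply: eq_bigr => i _; rewrite inE edge_colM scalerA.
  by case: (x i); rewrite ?mul0r ?scale0r // mul1r mulrC.
rewrite laplacianE sum_edge_type.
under [X in _ - X]eq_bigr do rewrite -edge_colM.
rewrite -sumrB /centered_sum mulmx_sumr mulmx_suml; apply: eq_bigr => i _.
rewrite iso_vecM scalerA -[in RHS]scalemxAr -[in RHS]scalemxAl.
have -> : Q *m (col (enum_rank i) Pi *m (col (enum_rank i) Pi)^T) *m Q^T =
    edge_col i *m (edge_col i)^T.
  by rewrite !mulmxA -mulmxA -trmx_mul mulmx_col mulmx_gram_proj col_wincidence.
by rewrite mulrBl divff ?gt_eqF ?sparsify_p_gt0 // scalerBl scale1r.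
Qed.

Lemma spectral_approx_of_trace x q : (0 < q)%N -> 0 <= eps ->
  \tr (Z x ^+ q.*2) <= eps ^+ q.*2 ->
  spectral_approx eps (laplacian (H x)) (laplacian G).
Proof.
move=> q_gt0 eps_ge0 trZ.
have sZ := centered_sum_sym (fun i : E => p i) iso_vec x.
have sG : (laplacian G)^T = laplacian G.
  by rewrite laplacian_wincidence trmx_mul trmxK.
have LH : laplacian (H x) = laplacian G + Q *m Z x *m Q^T.
  by rewrite -laplacian_sparsifyB addrC subrK.
have sH : (laplacian (H x))^T = laplacian (H x).
  by rewrite LH raddfD /= sG !trmx_mul sZ trmxK mulmxA.
(* The quadratic form of [Z] is taken at [Q^T u], whose squared norm is [qform u (laplacian G)]. *)
have main u : `|qform u (Q *m Z x *m Q^T)| <= eps * qform u (laplacian G).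
  have := qform_le_of_trace (Q^T *m u) sZ eps_ge0 q_gt0 trZ.
  by rewrite /qform trmx_mul trmxK laplacian_wincidence !mulmxA.
have sB (A B : 'M[R]_n) c : A^T = A -> B^T = B -> (A - c *: B)^T = A - c *: B.
  by move=> sA sB; rewrite linearB linearZ /= sA sB.
have sB' (A B : 'M[R]_n) c : A^T = A -> B^T = B -> (c *: B - A)^T = c *: B - A.
  by move=> sA sB1; rewrite linearB linearZ /= sA sB1.
move: (laplacian G) (laplacian (H x)) sG sH LH main => A B sA sB1 BE main.
split; split; [exact: sB| |exact: sB'|] => u; have := main u;
  by rewrite -/(qform u _) qformB qformZ BE qformD ler_norml => /andP[]; lra.
Qed.

Lemma card_sparsify_edges (x : {ffun E -> bool}) :
  #|edges (H x)|%:R = \sum_i (x i)%:R :> R.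
Proof.
rewrite /= /sparsify_edges card_imset; last exact: val_inj.
rewrite -sum1_card natr_sum big_mkcond /=; apply: eq_bigr => i _.
by rewrite inE; case: (x i).
Qed.

End Sparsify.

(** * Choice of the sampling rate *)

Section SamplingRate.
Variables (R : realType) (n q : nat) (eps delta : R).
Hypotheses (q_gt0 : (0 < q)%N) (k_le : q.*2%:R <= ln (n%:R : R)).
Hypotheses (eps01 : 0 < eps < 1) (delta01 : 0 < delta < 2%:R^-1).
Local Notation k := q.*2.
Local Notation s := (sparsify_s n k eps delta).
Local Notation T := ((n%:R / delta) `^ (2%:R / k%:R)).

Lemma sparsify_ln_gt0 : 0 < ln (n%:R : R).
Proof. by apply: lt_le_trans k_le; rewrite ltr0n double_gt0. Qed.

Lemma sparsify_n_gt0 : 0 < n%:R :> R.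
Proof.
rewrite ltr0n lt0n; apply/eqP => n0; have := sparsify_ln_gt0.
by rewrite n0 ln0 // ltxx.
Qed.

Lemma sparsify_power_gt0 : 0 < T.
Proof.
have /andP[d0 _] := delta01.
by apply: powR_gt0; rewrite divr_gt0 ?sparsify_n_gt0.
Qed.

(** The purpose of the power in [s]: raised to [q = k / 2] it cancels the factor [n] of the moment
    bound and leaves [delta]. *)
Lemma sparsify_powerX : T ^+ q = n%:R / delta.
Proof.
have /andP[d0 _] := delta01.
have nd0 : 0 <= n%:R / delta by rewrite divr_ge0 ?(ltW sparsify_n_gt0) ?ltW.
rewrite -powR_mulrn ?powR_ge0 // -powRrM (_ : 2%:R / _ * _ = 1) ?powRr1 //.
by rewrite mulrAC -natrM mul2n divff // pnatr_eq0 double_eq0 -lt0n.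
Qed.

Lemma expR1_ge2 : 2%:R <= expR 1 :> R.
Proof. by have := expR_ge1Dx (1 : R); rewrite (_ : 1 + 1 = 2%:R). Qed.

Lemma sparsify_s_gt0 : 0 < s.
Proof.
have /andP[e0 _] := eps01; rewrite /sparsify_s mulr_gt0 ?sparsify_power_gt0 //.
by rewrite divr_gt0 ?exprn_gt0 // mulr_gt0 ?sparsify_ln_gt0 // mulr_gt0 ?expR_gt0.
Qed.

(** Up to the factor [eps ^+ 2 / T] this is [5 k <= 18 e ln n], which follows from [k <= ln n] and
    [e >= 2]. *)
Lemma sparsify_scale_le : 5%:R * (k%:R * s^-1) <= eps ^+ 2 / T.
Proof.
have /andP[e0 _] := eps01; have T0 := sparsify_power_gt0.
have l0 := sparsify_ln_gt0; have e2 := expR1_ge2.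
have c0 : 0 < 18%:R * expR 1 * ln (n%:R : R).
  by rewrite mulr_gt0 // mulr_gt0 ?expR_gt0.
have -> : s^-1 = (18%:R * expR 1 * ln n%:R)^-1 * (eps ^+ 2 / T).
  by rewrite /sparsify_s !invfM invrK; ring.
rewrite (mulrA k%:R) (mulrA 5%:R) ler_piMl ?divr_ge0 ?sqr_ge0 ?(ltW T0) //.
rewrite mulrA ler_pdivrMr // mul1r; apply: (@le_trans _ _ (5%:R * ln n%:R)).
  by rewrite ler_pM2l.
by rewrite ler_pM2r //; lra.
Qed.

Lemma sparsify_power_ge1 : 1 <= T.
Proof.
have /andP[d0 d1] := delta01.
rewrite -(@ler_pXn2r _ q) ?nnegrE ?(ltW sparsify_power_gt0) //.
rewrite expr1n sparsify_powerX ler_pdivlMr // mul1r.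
apply: (@le_trans _ _ 1); first by lra.
by rewrite ler1n -(@ltr0n R) sparsify_n_gt0.
Qed.

Lemma sparsify_rate_le1 : k%:R * s^-1 <= 1.
Proof.
have /andP[e0 e1] := eps01.
have : eps ^+ 2 / T <= 1.
  rewrite ler_pdivrMr ?sparsify_power_gt0 // mul1r.
  by apply: le_trans sparsify_power_ge1; rewrite expr_le1 ?ltW.
have : 0 <= k%:R * s^-1 by rewrite mulr_ge0 // invr_ge0 ltW ?sparsify_s_gt0.
by move: sparsify_scale_le; move: (k%:R * _) => r; lra.
Qed.

Lemma sparsify_moment_le :
  n%:R * (5%:R * (k%:R * s^-1)) ^+ q <= delta * eps ^+ k.
Proof.
have /andP[e0 e1] := eps01; have /andP[d0 _] := delta01.
apply: (@le_trans _ _ (n%:R * (eps ^+ 2 / T) ^+ q)).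
  apply: ler_wpM2l => //; rewrite ler_pXn2r ?sparsify_scale_le // nnegrE.
    by rewrite !mulr_ge0 // invr_ge0 ltW ?sparsify_s_gt0.
  by rewrite divr_ge0 ?sqr_ge0 ?(ltW sparsify_power_gt0).
rewrite exprMn exprVn sparsify_powerX -exprM mul2n le_eqVlt; apply/orP; left.
have n0 := sparsify_n_gt0; apply/eqP; field.
by rewrite !gt_eqF.
Qed.

(** The left side is the Markov threshold for the edge count: [n] and [1 / delta] supply the
    exponent 1, the power in [s] supplies [2 / k], and [18 e] becomes the constant [C]. *)
Lemma sparsify_edge_bound : n%:R * s / delta =
  18%:R * expR 1 * (1 / (delta `^ (1 + 2%:R / k%:R)) * (ln n%:R / eps ^+ 2)
             * (n%:R `^ (1 + 2%:R / k%:R))).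
Proof.
have /andP[e0 e1] := eps01; have /andP[d0 _] := delta01.
have n0 := sparsify_n_gt0.
have Spow (a : R) : 0 < a -> a `^ (1 + 2%:R / k%:R) = a * a `^ (2%:R / k%:R).
  move=> a0; rewrite (@powRD _ a 1); last by rewrite (gt_eqF a0) implybT.
  by rewrite powRr1 // ltW.
have powRV r : delta^-1 `^ r = (delta `^ r)^-1.
  by rewrite -powR_inv1 ?ltW // -powRrM mulN1r powRN.
rewrite !Spow // /sparsify_s powRM ?invr_ge0 ?ltW // powRV.
by field; rewrite !gt_eqF ?powR_gt0.
Qed.

End SamplingRate.

Theorem theorem3p1 (R : realType) :
  exists2 C : R, 0 < C &
  forall (n : nat) (G : wgraph R n) (eps delta : R) (k : nat)
         (mu : {ffun edge_type G -> bool} -> R),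
    positive_weights G -> connected_graph G ->
    0 < eps < 1 -> 0 < delta < 2%:R^-1 ->
    (0 < k)%N -> ~~ odd k -> k%:R <= ln (n%:R : R) ->
    sparsify_sampling (eff_resistance G) k eps delta mu ->
    1 - 2%:R * delta <=
    Prob mu (fun x =>
      let H := sparsify (eff_resistance G) k eps delta x in
      spectral_approx eps (laplacian H) (laplacian G) /\
      #|edges H|%:R <=
        C * (1 / (delta `^ (1 + 2%:R / k%:R)) * (ln n%:R / eps ^+ 2)
             * (n%:R `^ (1 + 2%:R / k%:R)))).
Proof.
exists (18%:R * expR 1); first by rewrite mulr_gt0 ?expR_gt0.
move=> n G eps delta k mu w_gt0 _ eps01 delta01 k_gt0 k_even k_le [].
move=> [mu_ge0 mu1] mu_kwise.
have kE : k = k./2.*2 by rewrite even_halfK.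
move: (k./2) kE => q kE; subst k; have q_gt0 : (0 < q)%N by rewrite -double_gt0.
have /andP[eps_gt0 _] := eps01; have /andP[delta_gt0 _] := delta01.
have s_gt0 := sparsify_s_gt0 q_gt0 k_le eps01 delta01.
pose p (i : edge_type G) := sparsify_p G (eff_resistance G) q.*2 eps delta (val i).
pose Z := centered_sum p (@iso_vec R n G q.*2 eps delta).
have Z_sym x : (Z x)^T = Z x by exact: centered_sum_sym.
have p01 i : 0 <= p i <= 1 by exact: sparsify_p01.
pose N := n%:R * sparsify_s n q.*2 eps delta.
have N_gt0 : 0 < N by rewrite mulr_gt0 // (sparsify_n_gt0 q_gt0 k_le).
(* The trace has degree [q.*2 = k] in the bits, so its mean may be computed under the product
   measure; Markov at [eps ^+ q.*2] leaves [delta]. *)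
have trace_tail : Prob mu (fun x => ~ \tr (Z x ^+ q.*2) <= eps ^+ q.*2) <= delta.
  apply: Markov; rewrite ?exprn_gt0 //; first by move=> x; exact: mxtrace_pow_ge0.
  have := @fooled_trace_pow _ _ _ p
    (@iso_vec R n G q.*2 eps delta) _ mu q.*2 mu_kwise.
  move/fooledE => ->.
  apply: le_trans (sparsify_moment_le q_gt0 k_le eps01 delta01).
  apply: moment_bound => //.
  - by rewrite invr_ge0 ltW.
  - by move=> i; exact: iso_vec_le.
  - by move=> u; rewrite sum_iso_vec //; exact: qform_gram_proj_le.
  - exact: sum_iso_vec_dot.
  - exact: sparsify_rate_le1.
have edge_tail : Prob mu (fun x =>
    ~ #|edges (sparsify (eff_resistance G) q.*2 eps delta x)|%:R <= N / delta) <=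
    delta.
  (* The mean edge count is at most [N], so the threshold [N / delta] fails with probability at most
     [delta]. *)
  apply: Markov; rewrite ?divr_gt0 // mulrC divfK ?gt_eqF //.
  under eq_Expect do rewrite card_sparsify_edges.
  rewrite Expect_sum; apply: le_trans (sum_sparsify_p_le w_gt0 s_gt0).
  apply: ler_sum => i _; rewrite le_eqVlt; apply/orP; left; apply/eqP.
  have := @Expect_kwise_set _ _ _ _ _ mu_kwise [set i]%SET.
  rewrite cards1 finset.big_set1 => <- //.
  by apply: eq_Expect => x; rewrite finset.big_set1.
apply: le_trans (_ : 1 - (delta + delta) <= _); first by lra.
apply: le_trans (Prob_and_ge mu_ge0 mu1 trace_tail edge_tail) _.
apply: ler_Prob => // x [trZ edges_le]; split; last first.
  by rewrite -sparsify_edge_bound.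
exact: (spectral_approx_of_trace w_gt0 s_gt0 q_gt0 (ltW eps_gt0) trZ).
Qed.
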